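(* Let $n\geq 2m\ge4$ and write $G_{p^s}=G_{p^s}(n,m)$, $G_p=G_p(n,m)$. Then $$p^{(s-1)(m-1)(n-m)}\alpha (G_{p})\leq\alpha (G_{p^s})\leq p^{(s-1)(m-1)(n-m)}\frac{{n\brack m}_p }{{n-m+1\brack 1}_p},$$ where $\alpha(\cdot)$ denotes the independence number.
   Context: $p$ is a prime, $s\ge1$, $R=\mathbb{Z}_{p^s}$; vectors are row vectors. A set $\{\alpha_1,\dots,\alpha_k\}\subseteq R^n$ is unimodular if the matrix with rows $\alpha_i$ has a right inverse. For a submodule $V$, $\dim(V)$ is the largest size of a unimodular subset. A $k$-subspace is a submodule with a unimodular basis of $k$ vectors. $G_{p^s}(n,m)$ has vertex set the $m$-subspaces of $\mathbb{Z}_{p^s}^n$, with $A\sim B$ iff $A\cap B$ is a linear subset of dimension $m-1$ ($G_p(n,m)$ is the case $s=1$, the classical Grassmann graph over $\mathbb{Z}_p$). Gaussian binomial: ${n\brack k}_q=\prod_{i=1}^k\frac{q^{n+1-i}-1}{q^i-1}$. *)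

(* Defs.v *)
From HB Require Import structures.
From mathcomp Require Import all_boot all_order all_algebra.
Set Implicit Arguments.
Unset Strict Implicit.
Unset Printing Implicit Defensive.
Import Order.TTheory GRing.Theory Num.Theory.
Local Open Scope ring_scope.

Section Modules.

(* Finiteness makes all the predicates below decidable. *)
Variables (R : finComUnitRingType) (n : nat).
Implicit Types A V : {set 'rV[R]_n}.

Definition submodule V : bool :=
  [&& 0 \in V,
      [forall u in V, forall v in V, u + v \in V]
    & [forall a : R, forall v in V, a *: v \in V]].

Definition rows_mx A : 'M[R]_(#|A|, n) := \matrix_(i < #|A|) enum_val i.

(* The order in which the vectors of A are listed as rows is irrelevant: it only
   permutes the columns of a right inverse. *)
Definition unimodular A : bool :=
  [exists B : 'M[R]_(n, #|A|), rows_mx A *m B == 1%:M].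

Definition mdim V : nat :=
  \max_(A : {set 'rV[R]_n} | (A \subset V) && unimodular A) #|A|.

Definition mspan A : {set 'rV[R]_n} :=
  [set v | [exists c : {ffun 'rV[R]_n -> R}, v == \sum_(a in A) c a *: a]].

Definition linindep A : bool :=
  [forall c : {ffun 'rV[R]_n -> R},
    (\sum_(a in A) c a *: a == 0) ==> [forall a in A, c a == 0]].

Definition basis A V : bool := linindep A && (mspan A == V).

Definition ksubspace (k : nat) V : bool :=
  submodule V &&
  [exists A : {set 'rV[R]_n}, [&& #|A| == k, unimodular A & basis A V]].

End Modules.

(* For p prime and s >= 1 we have p ^ s >= 2, so that 'Z_(p ^ s) really is the
   ring of integers modulo p ^ s. *)
Definition grass_vertex (p s n m : nat) : finType :=
  {V : {set 'rV['Z_(p ^ s)]_n} | ksubspace m V}.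

Definition grass_adj (p s n m : nat) : rel (grass_vertex p s n m) :=
  fun A B => submodule (val A :&: val B) && (mdim (val A :&: val B) == m.-1).

Definition independent (T : finType) (e : rel T) (S : {set T}) : bool :=
  [forall x in S, forall y in S, (x != y) ==> ~~ e x y].

Definition independence_number (T : finType) (e : rel T) : nat :=
  \max_(S : {set T} | independent e S) #|S|.

Definition gauss_binom (q n k : nat) : rat :=
  \prod_(1 <= i < k.+1) ((q%:R ^+ (n + 1 - i) - 1) / (q%:R ^+ i - 1)).

(* Main.v *)
(** Let [pi : R -> F] be the residue map of a finite local ring.  A matrix over
    [R] is unimodular iff its reduction has full row rank, and two distinct
    m-subspaces with unimodular bases [M], [N] are adjacent iff [Y M = Z N] for
    some unimodular [(m-1) x m] matrices [Y], [Z].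

    Upper bound: for an independent set [S] the map [(V, Y) |-> Y M_V] into the
    unimodular [(m-1) x n] matrices is injective, and unimodular matrices are
    counted by reduction to [F].

    Lower bound: complete a basis of every [V] in an independent set over [F] to
    an invertible matrix and lift it to [(L, K)].  The lifts of [V] are spanned by
    [L + D K] with [D] over [ker pi].  Two lifts of the same [V] are adjacent only
    if the difference of the matrices [D] has the form [u w] with [u] a unimodular
    column.  Hence we let [D] range over the solutions of
    [\sum_i (row i D) C_i = 0], where the [C_i] lift the multiplication operators
    of [F_(p^(n-m))] by linearly independent elements: then [u w] is sent to
    [w (\sum_i u_i C_i)], with an invertible second factor.  The first row of [D]
    is determined by the others, which are free. *)
Require Import Defs.
From HB Require Import structures.
From mathcomp Require Import all_boot all_order all_algebra all_field ring.
Set Implicit Arguments.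
Unset Strict Implicit.
Unset Printing Implicit Defensive.
Import Order.TTheory GRing.Theory Num.Theory.
Local Open Scope ring_scope.

(** * Full-rank matrices over a finite field: counting and completion *)

Section RowFree.
Variable F : finFieldType.

Lemma row_free_col_mx1 k n (v : 'rV[F]_n) (B : 'M[F]_(k, n)) :
  row_free (col_mx v B) = row_free B && ~~ (v <= B)%MS.
Proof.
have le1 : (\rank (v + B)%MS <= 1 + \rank B)%N.
  by apply: leq_trans (mxrank_adds_leqif v B) _; rewrite leq_add2r rank_leq_row.
rewrite /row_free -addsmxE; apply/eqP/andP => [rk | [/eqP rkB nvB]].
  have rkB : \rank B = k.
    by apply/eqP; rewrite eqn_leq rank_leq_row -(leq_add2l 1) -{1}rk.
  split; first exact/eqP.
  apply/negP => /addsmx_idPr eqB; move/eqP: rk.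
  by rewrite eqB rkB eqn_leq add1n ltnn andbF.
suff ltr : (\rank B < \rank (v + B)%MS)%N.
  by apply/eqP; rewrite eqn_leq; move: le1 ltr; rewrite rkB add1n => -> ->.
by rewrite (ltn_leqif (mxrank_leqif_sup _)) ?addsmxSr // addsmx_sub submx_refl andbT.
Qed.

Lemma card_submx k n (B : 'M[F]_(k, n)) :
  row_free B -> #|[pred v : 'rV[F]_n | (v <= B)%MS]| = (#|F| ^ k)%N.
Proof.
move=> fB; rewrite -[k in RHS]mul1n -card_mx -(card_imset _ (row_free_inj fB)).
apply: eq_card => v; rewrite inE; apply/submxP/imsetP => [[D ->] | [D _ ->]].
  by exists D.
by exists D.
Qed.

(** Rows are prepended one at a time: over a row-free [B] with [k] rows, the admissible new rows are
    the [#|F| ^ n - #|F| ^ k] vectors outside its row space. *)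
Lemma card_row_free k n :
  #|[pred A : 'M[F]_(k, n) | row_free A]|
    = (\prod_(i < k) (#|F| ^ n - #|F| ^ i))%N.
Proof.
elim: k => [|k IHk].
  rewrite big_ord0 (@eq_card1 _ (0 : 'M_(0, n))) // => A.
  by rewrite !inE flatmx0 eqxx /row_free mxrank0.
rewrite big_ord_recr /= -IHk -sum_nat_const -sum1_card -add1n.
rewrite (partition_big dsubmx (fun B => row_free B)) /=; last first.
  by move=> A; rewrite inE -{1}(vsubmxK A) row_free_col_mx1 => /andP[].
apply: eq_bigr => B fB.
rewrite (reindex (col_mx^~ B)) /=; last first.
  exists usubmx => [v _ | A]; first by rewrite col_mxKu.
  by case/andP=> _ /eqP <-; rewrite vsubmxK.
rewrite -(card_submx fB) -[n in (_ ^ n)%N]mul1n -card_mx.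
rewrite -(cardC [pred v : 'rV[F]_n | (v <= B)%MS]) addKn.
rewrite -sum1_card; apply: eq_bigl => v.
by rewrite !inE col_mxKd eqxx andbT row_free_col_mx1 fB.
Qed.

(** [A] is an invertible matrix times the top [k] rows of [row_ebase A], so the remaining rows of
    [row_ebase A] complete it. *)
Lemma row_free_extend k l (A : 'M[F]_(k, k + l)) :
  row_free A -> exists K : 'M[F]_(l, k + l), col_mx A K \in unitmx.
Proof.
move=> /eqP rkA; exists (dsubmx (row_ebase A)).
have eA : A = col_ebase A *m usubmx (row_ebase A).
  rewrite -{1}(mulmx_ebase A) rkA pid_mx_row -mulmxA -{1}(vsubmxK (row_ebase A)).
  by rewrite mul_row_col mul1mx mul0mx addr0.
have -> : col_mx A (dsubmx (row_ebase A))
    = block_mx (col_ebase A) 0 0 1%:M *m row_ebase A.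
  rewrite -{2}(vsubmxK (row_ebase A)) mul_block_col !mul0mx mul1mx addr0 add0r.
  by rewrite -eA.
by rewrite unitmx_mul row_ebase_unit andbT unitmxE det_ublock det1 mulr1
  -unitmxE col_ebase_unit.
Qed.

End RowFree.

(** Every fibre is a translate of the kernel. Cross-multiplying keeps the count in the natural
    numbers. *)
Lemma card_preim_surj (U V : finZmodType) (f : {additive U -> V}) (P : pred V) :
  (forall y, exists x, f x = y) -> (#|[pred x | P (f x)]| * #|V| = #|P| * #|U|)%N.
Proof.
move=> f_surj.
have fib y : #|[pred x | f x == y]| = #|[pred x | f x == 0]|.
  have [x0 <-] := f_surj y.
  rewrite -[RHS](card_imset _ (addrI x0)); apply: eq_card => x; rewrite !inE.
  apply/eqP/imsetP => [fx | [z]]; last first.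
    by rewrite inE => /eqP fz ->; rewrite raddfD fz addr0.
  by exists (x - x0); rewrite ?inE ?raddfB ?fx ?subrr // addrC subrK.
have cnt (Q : pred V) : #|[pred x | Q (f x)]| = (#|Q| * #|[pred x | f x == 0%R]|)%N.
  rewrite -sum_nat_const -sum1_card (partition_big f Q) //.
  apply: eq_bigr => y Qy; rewrite -(fib y) -sum1_card; apply: eq_bigl => x.
  by rewrite !inE; case: eqP => [->|]; rewrite ?andbT ?andbF.
rewrite cnt -mulnA; congr (_ * _)%N; rewrite mulnC.
by rewrite -(cnt predT); apply: eq_card.
Qed.

Lemma independence_number_max (T : finType) (e : rel T) :
  {S | independent e S & independence_number e = #|S|}.
Proof.
apply: (@eq_bigmax_cond _ (independent e) (fun S => #|S|)).
by apply/card_gt0P; exists set0; apply/forall_inP => x; rewrite inE.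
Qed.

(** * Unimodular matrices over a finite local ring *)

Section LocalRing.
Variables (R : finComUnitRingType) (F : finFieldType) (pi : {rmorphism R -> F}).
Hypothesis pi_unit : forall x, (x \is a GRing.unit) = (pi x != 0).
Hypothesis pi_surj : forall y, exists x, pi x = y.

Local Notation red := (map_mx pi).

Definition unimod k n (M : 'M[R]_(k, n)) : bool := row_free (red M).

Lemma red_surj k n (A : 'M[F]_(k, n)) : exists M : 'M[R]_(k, n), red M = A.
Proof.
have [s sE] := fin_all_exists pi_surj.
by exists (map_mx s A); apply/matrixP => i j; rewrite !mxE sE.
Qed.

Lemma red_unitmx k (M : 'M[R]_k) : (red M \in unitmx) = (M \in unitmx).
Proof. by rewrite !unitmxE det_map_mx unitfE pi_unit. Qed.

(** A right inverse over [F] lifts to some [N']; then [M *m N'] reduces to the identity, hence is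
    invertible, and its inverse corrects [N']. *)
Lemma unimodP k n (M : 'M[R]_(k, n)) :
  reflect (exists N : 'M[R]_(n, k), M *m N = 1%:M) (unimod M).
Proof.
apply: (iffP row_freeP) => [[N MN] | [N MN]]; last first.
  by exists (red N); rewrite -map_mxM MN map_mx1.
have [N' N'E] := red_surj N.
have uMN : M *m N' \in unitmx by rewrite -red_unitmx map_mxM N'E MN unitmx1.
by exists (N' *m invmx (M *m N')); rewrite mulmxA mulmxV.
Qed.

Lemma unimod_mull k l n (Y : 'M[R]_(k, l)) (M : 'M[R]_(l, n)) :
  unimod (Y *m M) -> unimod Y.
Proof. by case/unimodP => N; rewrite -mulmxA => YMN; apply/unimodP; exists (M *m N). Qed.

Lemma unimod_mul k l n (Y : 'M[R]_(k, l)) (M : 'M[R]_(l, n)) :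
  unimod Y -> unimod M -> unimod (Y *m M).
Proof. by move=> uY uM; rewrite /unimod map_mxM /row_free mxrankMfree. Qed.

Lemma unimod_inj k l n (M : 'M[R]_(l, n)) :
  unimod M -> injective (fun Y : 'M[R]_(k, l) => Y *m M).
Proof.
case/unimodP => N MN; apply: (can_inj (g := mulmx^~ N)) => Y.
by rewrite -mulmxA MN mulmx1.
Qed.

Lemma unimod_unitmx k (M : 'M[R]_k) : unimod M = (M \in unitmx).
Proof. by rewrite /unimod row_free_unit red_unitmx. Qed.

Lemma unimod_rowsub k l n (f : 'I_k -> 'I_l) (M : 'M[R]_(l, n)) :
  injective f -> unimod M -> unimod (rowsub f M).
Proof.
move=> f_inj /unimodP[N MN]; apply/unimodP; exists (colsub f N).
by rewrite -mxsub_mul MN; apply/matrixP => i j; rewrite !mxE (inj_eq f_inj).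
Qed.

Lemma unimod_row_inj k n (M : 'M[R]_(k, n)) : unimod M -> injective (fun i => row i M).
Proof.
case/unimodP => N MN i j /(congr1 (mulmx^~ N)).
rewrite -!row_mul MN !row1 => /matrixP/(_ 0 i)/eqP; rewrite !mxE !eqxx /=.
by case: (i =P j) => //= _; rewrite oner_eq0.
Qed.

Lemma card_unimod k n :
  (#|[pred M : 'M[R]_(k, n) | unimod M]| * #|F| ^ (k * n)
    = (\prod_(i < k) (#|F| ^ n - #|F| ^ i)) * #|R| ^ (k * n))%N.
Proof.
rewrite -card_row_free -!card_mx.
exact: (@card_preim_surj 'M[R]_(k, n) 'M[F]_(k, n) red _ (@red_surj k n)).
Qed.

Lemma card_red0 k n :
  (#|[pred M : 'M[R]_(k, n) | red M == 0%R]| * #|F| ^ (k * n) = #|R| ^ (k * n))%N.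
Proof.
rewrite -!card_mx -[RHS]mul1n -(card1 (0 : 'M[F]_(k, n))).
exact: (@card_preim_surj 'M[R]_(k, n) 'M[F]_(k, n) red (pred1 0) (@red_surj k n)).
Qed.

(** * Row spans, and the translation of the set-based definitions into matrices *)

Definition rowspan k n (M : 'M[R]_(k, n)) : {set 'rV[R]_n} :=
  [set x *m M | x : 'rV[R]_k].

Lemma mulmx_rowspan k n (x : 'rV[R]_k) (M : 'M[R]_(k, n)) : x *m M \in rowspan M.
Proof. exact: imset_f. Qed.

Lemma rows_in_rowspan k l n (X : 'M[R]_(k, n)) (M : 'M[R]_(l, n)) :
  (forall i, row i X \in rowspan M) <-> exists Y, X = Y *m M.
Proof.
split=> [XM | [Y ->] i]; last by rewrite row_mul; apply: mulmx_rowspan.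
have : forall i, exists y, row i X = y *m M.
  by move=> i; have /imsetP[y _ yE] := XM i; exists y.
case/fin_all_exists => y yE; exists (\matrix_i y i).
by apply/row_matrixP => i; rewrite yE row_mul rowK.
Qed.

Lemma rowspan_sub k l n (Y : 'M[R]_(k, l)) (M : 'M[R]_(l, n)) :
  rowspan (Y *m M) \subset rowspan M.
Proof. by apply/subsetP => _ /imsetP[x _ ->]; rewrite mulmxA mulmx_rowspan. Qed.

Lemma unimodularE n (A : {set 'rV[R]_n}) : unimodular A = unimod (rows_mx A).
Proof.
apply/existsP/unimodP => [[N /eqP MN] | [N MN]]; exists N => //.
exact/eqP.
Qed.

Lemma row_rows_mx n (A : {set 'rV[R]_n}) i : row i (rows_mx A) = enum_val i.
Proof. by rewrite rowK. Qed.

Lemma sum_rows_mx n (A : {set 'rV[R]_n}) (c : 'rV[R]_n -> R) :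
  \sum_(a in A) c a *: a = (\row_i c (enum_val i)) *m rows_mx A.
Proof.
rewrite mulmx_sum_row big_enum_val.
by apply: eq_bigr => i _; rewrite row_rows_mx mxE.
Qed.

Lemma mspanE n (A : {set 'rV[R]_n}) : mspan A = rowspan (rows_mx A).
Proof.
apply/setP => v; rewrite inE; apply/existsP/imsetP => [[c /eqP ->] | [x _ ->]].
  by rewrite sum_rows_mx; eexists.
(* For [a] in [A] this sum has a single term, since [enum_val] is injective. *)
exists [ffun a => \sum_(i | enum_val i == a) x 0 i]; rewrite sum_rows_mx.
apply/eqP; congr (_ *m _); apply/rowP => i; rewrite !mxE ffunE.
by rewrite (big_pred1 i) // => j; rewrite /= (inj_eq enum_val_inj).
Qed.

Lemma unimodular_linindep n (A : {set 'rV[R]_n}) : unimodular A -> linindep A.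
Proof.
rewrite unimodularE => uA; apply/forallP => c; apply/implyP.
rewrite sum_rows_mx -(mul0mx _ (rows_mx A)) => /eqP/(unimod_inj uA) c0.
apply/forall_inP => a aA; move/rowP: c0 => /(_ (enum_rank_in aA a)).
by rewrite !mxE enum_rankK_in // => ->.
Qed.

Lemma submodule_rowspan k n (M : 'M[R]_(k, n)) : submodule (rowspan M).
Proof.
apply/and3P; split.
- by rewrite -(mul0mx _ M) mulmx_rowspan.
- apply/forall_inP => _ /imsetP[x _ ->]; apply/forall_inP => _ /imsetP[y _ ->].
  by rewrite -mulmxDl mulmx_rowspan.
- apply/forallP => a; apply/forall_inP => _ /imsetP[x _ ->].
  by rewrite scalemxAl mulmx_rowspan.
Qed.

Lemma submoduleI n (V W : {set 'rV[R]_n}) :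
  submodule V -> submodule W -> submodule (V :&: W).
Proof.
move=> /and3P[V0 VD VZ] /and3P[W0 WD WZ]; apply/and3P; split.
- by rewrite inE V0.
- apply/forall_inP => u; rewrite inE => /andP[uV uW].
  apply/forall_inP => v; rewrite inE => /andP[vV vW]; rewrite inE.
  by rewrite (forall_inP (forall_inP VD u uV)) // (forall_inP (forall_inP WD u uW)).
- apply/forallP => a; apply/forall_inP => v; rewrite !inE => /andP[vV vW].
  by rewrite (forall_inP (forallP VZ a)) // (forall_inP (forallP WZ a)).
Qed.

Section RowSet.
Variables (k n : nat) (M : 'M[R]_(k, n)).
Hypothesis uM : unimod M.
Let A := [set row i M | i : 'I_k].

Lemma card_rowset : #|A| = k.
Proof. by rewrite card_imset ?card_ord //; apply: unimod_row_inj. Qed.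

(** [rows_mx] lists the set in its own enumeration order, so the rows of [M] come back only up to a
    reindexing [f]. *)
Lemma rows_mx_rowset : exists2 f : 'I_#|A| -> 'I_k,
  injective f & rows_mx A = rowsub f M.
Proof.
have : forall i : 'I_#|A|, exists j, enum_val i = row j M.
  by move=> i; have /imsetP[j _ jE] := enum_valP i; exists j.
case/fin_all_exists => f fE; exists f.
  by move=> i j fij; apply: enum_val_inj; rewrite !fE fij.
by apply/row_matrixP => i; rewrite row_rows_mx fE row_rowsub.
Qed.

Lemma unimodular_rowset : unimodular A.
Proof.
by rewrite unimodularE; have [f finj ->] := rows_mx_rowset; apply: unimod_rowsub.
Qed.

Lemma ksubspace_rowspan : ksubspace k (rowspan M).
Proof.
rewrite /ksubspace submodule_rowspan; apply/existsP; exists A.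
rewrite card_rowset eqxx unimodular_rowset /basis /=.
rewrite unimodular_linindep ?unimodular_rowset //=.
rewrite mspanE eqEsubset; apply/andP; split.
  have [f _ ->] := rows_mx_rowset; rewrite rowsubE; exact: rowspan_sub.
have [|Y ->] := (rows_in_rowspan M (rows_mx A)).1; last exact: rowspan_sub.
move=> i; have iA : row i M \in A by apply: imset_f.
by rewrite -(enum_rankK_in iA iA) -row_rows_mx rowE mulmx_rowspan.
Qed.

End RowSet.

Lemma ksubspaceP k n (V : {set 'rV[R]_n}) :
  ksubspace k V -> exists2 M : 'M[R]_(k, n), unimod M & V = rowspan M.
Proof.
case/andP => _ /existsP[A /and3P[/eqP <- uA /andP[_ /eqP <-]]].
by exists (rows_mx A); rewrite ?mspanE // -unimodularE.
Qed.

(** A subfamily of a unimodular family is unimodular, so a maximum unimodular set can be cut down to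
    its first [k] rows. *)
Lemma mdim_geP k n (V : {set 'rV[R]_n}) :
  (k <= mdim V)%N <-> exists2 X : 'M[R]_(k, n), unimod X & forall i, row i X \in V.
Proof.
split=> [| [X uX XV]]; last first.
  rewrite -(card_rowset uX); apply: leq_bigmax_cond; rewrite unimodular_rowset // andbT.
  by apply/subsetP => _ /imsetP[i _ ->].
(* The empty set makes the family of candidates nonempty, so that the maximum is attained. *)
have u0 : unimodular (set0 : {set 'rV[R]_n}).
  rewrite unimodularE; apply/unimodP; exists 0; apply/matrixP => i.
  by have := ltn_ord i; rewrite {2}cards0.
pose P := [pred A : {set 'rV[R]_n} | (A \subset V) && unimodular A].
have -> : mdim V = (\max_(A in P) #|A|)%N by [].
have : (0 < #|P|)%N by apply/card_gt0P; exists set0; rewrite inE sub0set u0.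
case/(eq_bigmax_cond (fun A : {set 'rV[R]_n} => #|A|)) => A /andP[AV uA] -> kA.
exists (rowsub (widen_ord kA) (rows_mx A)).
  apply: unimod_rowsub; last by rewrite -unimodularE.
  by move=> i j /(congr1 val) /= ij; apply: val_inj.
move=> i; rewrite row_rowsub row_rows_mx; apply: (subsetP AV); exact: enum_valP.
Qed.

(* For subspaces with unimodular bases [M] and [N]: they share an
   (m-1)-subspace. *)
Definition meet1 m n (M N : 'M[R]_(m, n)) : Prop :=
  exists Y Z : 'M[R]_(m.-1, m), [/\ unimod Y, unimod Z & Y *m M = Z *m N].

(** The coefficient matrix [Y] is square and unimodular, hence invertible, which reverses the
    inclusion. *)
Lemma full_rowspan m n (X M : 'M[R]_(m, n)) : unimod X ->
  (forall i, row i X \in rowspan M) -> rowspan X = rowspan M.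
Proof.
move=> uX /rows_in_rowspan[Y XE]; apply/eqP; rewrite eqEsubset XE rowspan_sub /=.
have uY : Y \in unitmx.
  by rewrite -unimod_unitmx; apply: unimod_mull (_ : unimod (Y *m M)); rewrite -XE.
by rewrite -{1}(mulKmx uY M) rowspan_sub.
Qed.

(** A unimodular family of [m.+1] vectors in the intersection would span both subspaces, so the
    dimension is at most [m]. Only the existence of [m] such vectors remains to be expressed by
    coefficient matrices. *)
Lemma mdim_meet m n (M N : 'M[R]_(m.+1, n)) : unimod M -> unimod N ->
  rowspan M != rowspan N ->
  (mdim (rowspan M :&: rowspan N) == m) <-> meet1 M N.
Proof.
move=> uM uN neqMN.
have small : (mdim (rowspan M :&: rowspan N) <= m)%N.
  rewrite leqNgt; apply/negP => /mdim_geP[X uX XMN]; case/eqP: neqMN.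
  by rewrite -(full_rowspan (M := M) uX) ?(full_rowspan (M := N) uX) // => i;
    have := XMN i; rewrite inE => /andP[].
rewrite eqn_leq small /=; split.
  case/mdim_geP => X uX XMN.
  have [|Y YE] := (rows_in_rowspan X M).1.
    by move=> i; have := XMN i; rewrite inE => /andP[].
  have [|Z ZE] := (rows_in_rowspan X N).1.
    by move=> i; have := XMN i; rewrite inE => /andP[].
  exists Y, Z; split; last by rewrite -YE.
    by apply: (@unimod_mull _ _ _ Y M); rewrite -YE.
  by apply: (@unimod_mull _ _ _ Z N); rewrite -ZE.
case=> Y [Z [uY uZ YZ]]; apply/mdim_geP; exists (Y *m M); first exact: unimod_mul.
by move=> i; rewrite inE {2}YZ !row_mul !mulmx_rowspan.
Qed.

(** * Adjacency and independent sets in matrix terms *)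

Section Graph.
Variables n m : nat.
Local Notation vertex := {V : {set 'rV[R]_n} | ksubspace m.+1 V}.

(** The Grassmann adjacency over a general [R], for subspaces of dimension [m.+1]; it is convertible
    to [grass_adj] when [R] is ['Z_(p ^ s)]. *)
Definition radj : rel vertex := fun A B =>
  submodule (val A :&: val B) && (mdim (val A :&: val B) == m).

Lemma radj_meet (A B : vertex) (M N : 'M[R]_(m.+1, n)) :
    unimod M -> unimod N -> val A = rowspan M -> val B = rowspan N -> A != B ->
  radj A B <-> meet1 M N.
Proof.
move=> uM uN AM BN; rewrite -val_eqE AM BN => neq.
rewrite /radj AM BN submoduleI ?submodule_rowspan //; exact: mdim_meet.
Qed.

(** If [Y *m M A = Z *m M B] with [A != B], then [A] and [B] are adjacent; if [A = B], right
    cancellation of the unimodular basis gives [Y = Z]. *)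
Lemma independence_number_le :
  (independence_number radj * #|[pred Y : 'M[R]_(m, m.+1) | unimod Y]|
    <= #|[pred X : 'M[R]_(m, n) | unimod X]|)%N.
Proof.
have : forall A : vertex, exists2 M : 'M[R]_(m.+1, n), unimod M & val A = rowspan M.
  by move=> A; apply: ksubspaceP; apply: valP.
case/fin_all_exists2 => M uM AM.
have [S indS ->] := independence_number_max radj.
rewrite -[X in (_ * X)%N]cardsE -cardsX.
pose f (z : vertex * 'M[R]_(m, m.+1)) := z.2 *m M z.1.
rewrite -(card_in_imset (f := f)).
  apply/subset_leq_card/subsetP => _ /imsetP[[A Y] /setXP[_ uY] ->].
  by rewrite inE in uY; rewrite inE unimod_mul.
move=> [A Y] [B Z] /setXP[AS uY] /setXP[BS uZ]; rewrite /f /= => YZ.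
rewrite !inE in uY uZ.
have eAB : A = B.
  apply/eqP; apply: contraT => nAB.
  have /forall_inP/(_ B BS) := forall_inP indS A AS.
  rewrite nAB /= => /negP[]; apply/(radj_meet (uM A) (uM B)) => //.
  by exists Y, Z.
by rewrite eAB in YZ *; rewrite (unimod_inj (uM B) YZ).
Qed.

(** The separation hypothesis serves twice: it excludes adjacency, and it makes the row spans
    distinct, because equal row spans also satisfy [meet1]. *)
Lemma independence_number_ge (T : finType) (G : T -> 'M[R]_(m.+1, n)) :
    (forall t, unimod (G t)) -> (forall t u, meet1 (G t) (G u) -> t = u) ->
  (#|T| <= independence_number radj)%N.
Proof.
move=> uG sepG.
pose f t : vertex := exist (fun V => ksubspace m.+1 V) _ (ksubspace_rowspan (uG t)).
have f_inj : injective f.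
  move=> t u /(congr1 val) /= tu; apply: sepG.
  have [|P PE] := (rows_in_rowspan (G t) (G u)).1.
    by move=> i; rewrite -tu rowE mulmx_rowspan.
  (* Multiplying by [Y] drops the first row of [G t]; the remaining [m] rows witness [meet1]. *)
  pose Y : 'M[R]_(m, m.+1) := rowsub (lift ord0) 1%:M.
  have uY : unimod Y.
    by apply: unimod_rowsub; [exact: lift_inj | rewrite unimod_unitmx unitmx1].
  exists Y, (Y *m P); split=> //; last by rewrite -mulmxA -PE.
  by apply: (@unimod_mull _ _ _ _ (G u)); rewrite -mulmxA -PE; apply: unimod_mul.
rewrite -cardsT -(card_imset _ f_inj); apply: leq_bigmax_cond.
apply/forall_inP => _ /imsetP[t _ ->]; apply/forall_inP => _ /imsetP[u _ ->].
apply/implyP => ntu; apply/negP => adj.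
have tu : t = u.
  by apply: sepG; apply: (radj_meet (uG t) (uG u) _ _ ntu).1 adj.
by rewrite tu eqxx in ntu.
Qed.

End Graph.

(** * The matrix code and the lifting of independent sets *)

(** A matrix killed by [Y] is a column times a row [w], and the linear constraint then reads [w]
    times an invertible matrix equals 0. The equation on [l] reconciles [m.+1] with the shape
    [m + 1] of [row_free_extend]. *)
Lemma code_min_rank k m l (C : 'I_l -> 'M[R]_k) (D : 'M[R]_(l, k))
    (Y : 'M[R]_(m, l)) : l = (m + 1)%N ->
  (forall u : 'cV[R]_l, red u != 0 -> \sum_i u i 0 *: C i \in unitmx) ->
  \sum_i row i D *m C i = 0 -> unimod Y -> Y *m D = 0 -> D = 0.
Proof.
move=> el; subst l => C_unit DC uY YD.
have [yF] := row_free_extend uY; have [y <-] := red_surj yF.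
rewrite -map_col_mx red_unitmx => uP.
(* [u] is the last column of [invmx P]. Since [Y *m D = 0], the product [invmx P *m (P *m D)]
   collapses to [u *m (y *m D)]. *)
set P := col_mx Y y in uP; pose u := rsubmx (invmx P).
have yu : y *m u = 1%:M.
  have := mulmxV uP; rewrite -(hsubmxK (invmx P)) /P mul_col_row scalar_mx_block.
  by case/eq_block_mx.
have u0 : red u != 0.
  apply/eqP => u0; have /matrixP/(_ 0 0)/eqP : red (y *m u) = red 1%:M by rewrite yu.
  by rewrite map_mxM u0 mulmx0 map_mx1 !mxE eqxx eq_sym oner_eq0.
have DE : D = u *m (y *m D).
  rewrite -{1}(mulKmx uP D) /P mul_col_mx YD -/P -{1}(hsubmxK (invmx P)).
  by rewrite mul_row_col mulmx0 add0r.
have rowD i : row i D = u i 0 *: (y *m D).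
  rewrite {1}DE row_mul; move: (y *m D) => w.
  by apply/rowP => j; rewrite mxE big_ord1 !mxE.
suff yD : y *m D = 0 by rewrite DE yD mulmx0.
apply: (unimod_inj (M := \sum_i u i 0 *: C i)).
  by rewrite unimod_unitmx C_unit.
rewrite mul0mx -DC mulmx_sumr; apply: eq_bigr => i _.
by rewrite rowD -scalemxAl scalemxAr.
Qed.

Section Lift.
Variables (m k : nat) (T : finType) (B : T -> 'M[F]_(m.+1, m.+1 + k)).
Variable C : 'I_m.+1 -> 'M[F]_k.
Hypothesis B_free : forall t, row_free (B t).
Hypothesis B_sep : forall t u (Y Z : 'M[F]_(m, m.+1)),
  row_free Y -> row_free Z -> Y *m B t = Z *m B u -> t = u.
Hypothesis C_unit : forall u : 'cV[F]_m.+1, u != 0 -> \sum_i u i 0 *: C i \in unitmx.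

Lemma independence_number_lift :
  (#|T| * #|[pred E : 'M[R]_(m, k) | red E == 0%R]|
    <= independence_number (@radj (m.+1 + k) m))%N.
Proof.
have [K BK] := fin_all_exists (fun t => row_free_extend (B_free t)).
have [L LE] := fin_all_exists (fun t => red_surj (B t)).
have [J JE] := fin_all_exists (fun t => red_surj (K t)).
have [c cE] := fin_all_exists (fun i => red_surj (C i)).
have c_unit (u : 'cV[R]_m.+1) : red u != 0 -> \sum_i u i 0 *: c i \in unitmx.
  move=> u0; rewrite -red_unitmx map_mx_sum.
  rewrite (eq_bigr (fun i => red u i 0 *: C i)); first exact: C_unit.
  by move=> i _; rewrite map_mxZ cE mxE.
(* Take the first unit vector for [u]. *)
have c0_unit : c ord0 \in unitmx.
  have := c_unit (delta_mx ord0 0); rewrite (bigD1 ord0) //= big1 => [|i i0].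
    rewrite addr0 mxE !eqxx scale1r; apply; apply/eqP => /matrixP/(_ ord0 0)/eqP.
    by rewrite !mxE !eqxx rmorph1 oner_eq0.
  by rewrite mxE (negPf i0) scale0r.
(* [rho E] is the linear constraint solved for the first row of [D], given the other rows [E]. *)
pose rho (E : 'M[R]_(m, k)) :=
  - (\sum_i row i E *m c (lift ord0 i)) *m invmx (c ord0).
pose code (E : 'M[R]_(m, k)) : 'M[R]_(m.+1, k) := col_mx (rho E) E.
have code_red E : red E = 0 -> red (code E) = 0.
  move=> E0; rewrite /code [LHS](map_col_mx pi (rho E) E) E0 /rho.
  rewrite map_mxM map_mxN map_mx_sum big1.
    by rewrite oppr0 mul0mx col_mx0.
  by move=> i _; rewrite map_mxM map_row E0 row0 mul0mx.
have code_ker E : \sum_i row i (code E) *m c i = 0.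
  rewrite big_ord_recl /code.
  have -> : row ord0 (col_mx (rho E) E) = rho E.
    have -> : ord0 = lshift m ord0 :> 'I_(1 + m) by apply: val_inj.
    by rewrite [LHS](rowKu ord0 (rho E) E) row_id.
  rewrite /rho mulmxKV // addrC; apply/eqP; rewrite subr_eq0; apply/eqP.
  apply: eq_bigr => i _.
  have -> : lift ord0 i = rshift 1 i :> 'I_(1 + m) by apply: val_inj.
  by rewrite [row _ _](rowKd i (rho E) E).
pose W := {E : 'M[R]_(m, k) | red E == 0}.
pose G (z : T * W) := L z.1 + code (val z.2) *m J z.1.
have redG z : red (G z) = B z.1.
  by rewrite /G map_mxD map_mxM LE code_red ?mul0mx ?addr0 //; apply/eqP/(valP z.2).
have -> : (#|T| * #|[pred E : 'M[R]_(m, k) | red E == 0%R]| = #|{: T * W}|)%N.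
  by rewrite card_prod card_sig.
apply: (independence_number_ge (G := G)) => [z | [t E] [u E']].
  by rewrite /unimod redG.
case=> Y [Z [uY uZ YZ]].
(* Over [F] the lifts reduce to the bases [B], so a meeting of lifts reduces to a meeting excluded
   by [B_sep]. *)
have tu : t = u.
  apply: (B_sep uY uZ).
  by have := congr1 red YZ; rewrite !map_mxM !redG.
subst u; congr (_, _).
have uLJ : unimod (col_mx (L t) (J t)).
  by rewrite unimod_unitmx -red_unitmx map_col_mx LE JE.
(* Coordinates in the invertible matrix [(L, J)] are unique: the first block gives [Y = Z], the
   second says that [Y] kills the difference of the codewords. *)
have : row_mx Y (Y *m code (val E)) = row_mx Z (Z *m code (val E')).
  apply: (unimod_inj uLJ); rewrite !mul_row_col.
  by move: YZ; rewrite /G /= !mulmxDr !mulmxA.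
case/eq_row_mx => {uZ YZ} <- YEE'; apply: val_inj.
suff: code (val E) - code (val E') = 0 by move/subr0_eq/(@eq_col_mx _ 1) => [].
have DC : \sum_i row i (code (val E) - code (val E')) *m c i = 0.
  under eq_bigr => i _ do rewrite linearB mulmxBl.
  by rewrite sumrB !code_ker subrr.
have YD : Y *m (code (val E) - code (val E')) = 0 by rewrite mulmxBr YEE' subrr.
exact: code_min_rank (esym (addn1 m)) c_unit DC uY YD.
Qed.

End Lift.
(** Used for [s = 1], where ['Z_(p ^ 1)] and ['F_p] are isomorphic but distinct types: injectivity
    of [pi] carries a meeting over [F] back to [R]. *)
Lemma independent_reduction (pi_inj : injective pi) n m
    (S : {set {V : {set 'rV[R]_n} | ksubspace m.+1 V}}) :
  independent (@radj n m) S ->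
  exists2 B : {V | V \in S} -> 'M[F]_(m.+1, n), (forall t, row_free (B t))
    & forall t u (Y Z : 'M[F]_(m, m.+1)),
        row_free Y -> row_free Z -> Y *m B t = Z *m B u -> t = u.
Proof.
move=> indS.
have : forall t : {V | V \in S}, exists2 M : 'M[R]_(m.+1, n),
    unimod M & val (val t) = rowspan M.
  by move=> t; apply: ksubspaceP; apply: valP.
case/fin_all_exists2 => M uM tM; exists (fun t => red (M t)) => //.
move=> t u Y Z; have [Y1 <-] := red_surj Y; have [Z1 <-] := red_surj Z.
rewrite -!map_mxM => uY uZ YZ; apply/val_inj/eqP; apply: contraT => ntu.
have /forall_inP/(_ _ (valP u)) := forall_inP indS _ (valP t).
rewrite ntu /= => /negP[]; apply/(radj_meet (uM t) (uM u) (tM t) (tM u) ntu).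
exists Y1, Z1; split=> //; apply/matrixP => i j; apply: pi_inj.
by have /matrixP/(_ i j) := YZ; rewrite [LHS]mxE [RHS]mxE.
Qed.

End LocalRing.

(** * Multiplication matrices of a field extension *)

(** [C i] is multiplication by the [i]-th basis vector of [L], so a nontrivial combination is
    multiplication by a nonzero element, which has no kernel as [L] has no zero divisors. *)
Lemma field_mulmx (K : fieldType) (L : fieldExtType K) (k : nat) : \dim {:L} = k ->
  exists C : 'I_k -> 'M[K]_k,
    forall u : 'cV[K]_k, u != 0 -> \sum_i u i 0 *: C i \in unitmx.
Proof.
move=> <-; set b := vbasis {:L}.
exists (fun i => \matrix_(j, l) coord b l (b`_j * b`_i)) => u u0.
have freeb (w : 'I_(\dim {:L}) -> K) :
    \sum_i w i *: b`_i = 0 -> forall i, w i = 0.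
  by apply/freeP; apply: basis_free (vbasisP _).
rewrite -row_free_unit -kermx_eq0; apply/rowV0P => v /sub_kermxP vU.
have prod0 : (\sum_j v 0 j *: b`_j) * (\sum_i u i 0 *: b`_i) = 0.
  rewrite (coord_vbasis (memvf (_ * _))) big1 // => l _; rewrite -/b.
  suff -> : coord b l ((\sum_j v 0 j *: b`_j) * (\sum_i u i 0 *: b`_i)) = 0.
    by rewrite scale0r.
  have /rowP/(_ l) := vU; rewrite [RHS]mxE => <-; rewrite mxE.
  rewrite mulr_suml linear_sum; apply: eq_bigr => j _.
  rewrite summxE mulr_sumr linear_sum mulr_sumr; apply: eq_bigr => i _.
  by rewrite -scalerAl -scalerAr !linearZ !mxE.
move/eqP: prod0; rewrite mulf_eq0 => /orP[] /eqP /freeb w0.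
  by apply/rowP => j; rewrite w0 mxE.
case/eqP: u0; apply/matrixP => i j; by rewrite !ord1 w0 mxE.
Qed.

Lemma Fp_mulmx p k : prime p -> (0 < k)%N ->
  exists C : 'I_k -> 'M['F_p]_k,
    forall u : 'cV['F_p]_k, u != 0 -> \sum_i u i 0 *: C i \in unitmx.
Proof.
move=> p_pr k0; have [L charL cardL] := pPrimePowerField p_pr k0.
apply: (@field_mulmx _ (pPrimeCharType charL)).
by rewrite pprimeChar_dimf cardL pfactorK.
Qed.

(** * The residue map of the integers modulo a prime power *)

(** Reducing the representative modulo [p] respects the operations because [p] divides [p ^ s];
    being coprime to [p ^ s] is the same as not being divisible by [p]. *)
Lemma Zp_residue p s : prime p -> (0 < s)%N ->
  exists pi : {rmorphism 'Z_(p ^ s) -> 'F_p},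
    (forall x, (x \is a GRing.unit) = (pi x != 0)) /\ (forall y, exists x, pi x = y).
Proof.
move=> p_pr s0; have ps1 : (1 < p ^ s)%N by rewrite -(exp1n s) ltn_exp2r // prime_gt1.
pose f (x : 'Z_(p ^ s)) : 'F_p := (nat_of_ord x)%:R.
have f_nat (a : nat) : f a%:R = a%:R.
  rewrite /f val_Zp_nat // -(Fp_nat_mod p_pr) modn_dvdm ?Fp_nat_mod //.
  exact: dvdn_exp.
have fD : {morph f : x y / x + y}.
  by move=> x y; rewrite -(natr_Zp x) -(natr_Zp y) -natrD !f_nat natrD.
have fM : {morph f : x y / x * y}.
  by move=> x y; rewrite -(natr_Zp x) -(natr_Zp y) -natrM !f_nat natrM.
have f0 : f 0 = 0 by rewrite -[0]/(0%:R) f_nat.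
have f1 : f 1 = 1 by rewrite -[1]/(1%:R) f_nat.
have fB : zmod_morphism f.
  move=> x y; apply/eqP; rewrite eq_sym subr_eq -fD subrK //.
pose pi : {rmorphism 'Z_(p ^ s) -> 'F_p} :=
  HB.pack f (GRing.isZmodMorphism.Build _ _ f fB)
            (GRing.isMonoidMorphism.Build _ _ f (f1, fM)).
exists pi; split=> [x | y] /=.
  rewrite -{1}(natr_Zp x) unitZpE // coprime_pexpl // prime_coprime //.
  by rewrite /f -(dvdn_pcharf (pchar_Fp p_pr)).
by exists (nat_of_ord y)%:R; rewrite f_nat natr_Zp.
Qed.

(** * Gaussian binomials as quotients of matrix counts *)

(** For a prime power [q] the right side is the number of full-rank [m] by [n] matrices over that of
    [m] by [m.+1] ones. Writing [q ^ l - q ^ i] as [q ^ i * (q ^ (l - i) - 1)], the powers of [q]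
    cancel. *)
Lemma gauss_binom_quot q n m : (1 < q)%N -> (m < n)%N ->
  gauss_binom q n m.+1 / gauss_binom q (n - m.+1 + 1) 1
    = (\prod_(i < m) (q ^ n - q ^ i))%N%:R / (\prod_(i < m) (q ^ m.+1 - q ^ i))%N%:R.
Proof.
move=> q1 mn; set x : rat := q%:R.
have x1 : 1 < x by rewrite ltr1n.
have xn0 i : (0 < i)%N -> x ^+ i - 1 != 0.
  by move=> i0; rewrite subr_eq0 gt_eqF // exprn_egt1 // -lt0n.
have prodE l : (m <= l)%N -> (\prod_(i < m) (q ^ l - q ^ i))%N%:R
    = (\prod_(i < m) x ^+ i) * \prod_(i < m) (x ^+ (l - i) - 1).
  move=> ml; rewrite natr_prod -big_split; apply: eq_bigr => i _ /=.
  have il : (i <= l)%N by apply: leq_trans ml; apply: ltnW.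
  rewrite natrB ?leq_exp2l // !natrX mulrBr mulr1 -exprD subnKC //.
rewrite !prodE; [|exact: leqnSn|exact: ltnW].
have X0 : \prod_(i < m) x ^+ i != 0.
  by apply/prodf_neq0 => i _; rewrite expf_neq0 // gt_eqF // (lt_trans ltr01).
rewrite -mulf_div divff // mul1r /gauss_binom big_nat1 -/x.
rewrite prodf_div big_add1 /= big_nat_recr //= addn1 expr1 subn1 /=.
rewrite (big_nat_recl _ _ (fun i => x ^+ i - 1)) //.
have -> : \prod_(1 <= i < m.+1) (x ^+ i.+1 - 1) = \prod_(i < m) (x ^+ (m.+1 - i) - 1).
  rewrite big_add1 big_mkord (reindex_inj rev_ord_inj); apply: eq_bigr => i _ /=.
  by rewrite subnSK // subSn // ltnW.
have -> : (n - m.+1 + 1 + 1).-1 = (n - m)%N by rewrite !addn1 /= subnSK.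
rewrite big_mkord (subSS m n) expr1.
have t0 : x ^+ (n - m) - 1 != 0 by rewrite xn0 // subn_gt0.
have a0 : x - 1 != 0 by have := xn0 1%N isT; rewrite expr1.
have D0 : \prod_(i < m) (x ^+ (m.+1 - i) - 1) != 0.
  by apply/prodf_neq0 => i _; rewrite xn0 // subn_gt0 ltnS ltnW.
rewrite (eq_bigr (fun i : 'I_m => x ^+ (n - i) - 1)) => [|i _]; last by rewrite subSS.
by field; rewrite t0 a0 D0.
Qed.

(** * Assembly of the two bounds *)

Lemma independence_number_lift_le (R1 R : finComUnitRingType) (F : finFieldType)
    (pi1 : {rmorphism R1 -> F}) (pi : {rmorphism R -> F}) m k
    (C : 'I_m.+1 -> 'M[F]_k) :
    (forall x, (x \is a GRing.unit) = (pi1 x != 0)) -> bijective pi1 ->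
    (forall x, (x \is a GRing.unit) = (pi x != 0)) ->
    (forall y, exists x, pi x = y) ->
    (forall u : 'cV[F]_m.+1, u != 0 -> \sum_i u i 0 *: C i \in unitmx) ->
  (independence_number (@radj R1 (m.+1 + k) m)
     * #|[pred E : 'M[R]_(m, k) | map_mx pi E == 0%R]|
    <= independence_number (@radj R (m.+1 + k) m))%N.
Proof.
move=> pi1_unit pi1_bij pi_unit pi_surj C_unit.
have pi1_surj y : exists x, pi1 x = y by case: pi1_bij => g _ gK; exists (g y).
have [S indS ->] := independence_number_max (@radj R1 (m.+1 + k) m).
have [B B_free B_sep] := independent_reduction pi1_unit pi1_surj (bij_inj pi1_bij) indS.
by rewrite -card_sig; apply: independence_number_lift B_free B_sep C_unit.
Qed.

Theorem theorem4p5 (p s n m : nat) (p_prime : prime p) (s_ge1 : (1 <= s)%N)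
    (n_ge2m : (2 * m <= n)%N) (m2_ge4 : (4 <= 2 * m)%N) :
  ((p ^ ((s - 1) * (m - 1) * (n - m)) * independence_number (@grass_adj p 1 n m))%N%:R
     <= (independence_number (@grass_adj p s n m))%:R :> rat)
  /\
  ((independence_number (@grass_adj p s n m))%:R
     <= (p ^ ((s - 1) * (m - 1) * (n - m)))%N%:R
        * (gauss_binom p n m / gauss_binom p (n - m + 1) 1) :> rat).
Proof.
have p1 := prime_gt1 p_prime; have p0 := prime_gt0 p_prime.
have cardZ t : (0 < t)%N -> #|'Z_(p ^ t)| = (p ^ t)%N.
  by move=> t0; rewrite card_ord Zp_cast // -(exp1n t) ltn_exp2r.
case: m n_ge2m m2_ge4 => // m n_ge2m _; rewrite !subSS !subn0.
have [k nE] : exists k, n = (m.+1 + (m.+1 + k))%N.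
  by exists (n - 2 * m.+1)%N; rewrite addnA addnn -mul2n subnKC.
move: n_ge2m => _; rewrite {}nE addKn; set l := (m.+1 + k)%N.
have [pi [pi_unit pi_surj]] := Zp_residue p_prime s_ge1.
have [pi1 [pi1_unit pi1_surj]] := Zp_residue p_prime (ltnSn 0).
(* For [s = 1] both rings have [p] elements, so a section [g] of [pi1] is bijective and [pi1] is its
   inverse. *)
have pi1_bij : bijective pi1.
  apply: inj_card_bij; last by rewrite cardZ // card_Fp // expn1.
  have [g gK] := fin_all_exists pi1_surj.
  have gbij : bijective g.
    by apply: inj_card_bij (can_inj gK) _; rewrite cardZ // card_Fp // expn1.
  exact: can_inj ((bij_can_sym gbij _).2 gK).
(* Here [n >= 2m] enters: it gives [l >= m.+1], so [m.+1] of the [l] multiplication matrices can be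
   kept, padding [u] with zeros. *)
have [C C_unit] : exists C : 'I_m.+1 -> 'M['F_p]_l,
    forall u : 'cV_m.+1, u != 0 -> \sum_i u i 0 *: C i \in unitmx.
  have [C C_unit] := @Fp_mulmx p l p_prime isT.
  exists (fun i => C (lshift k i)) => u u0; rewrite /l in C C_unit *.
  have /C_unit : col_mx u (0 : 'cV_k) != 0 by rewrite col_mx_eq0 negb_and u0.
  rewrite big_split_ord /= [X in _ + X]big1 ?addr0 => [|i _].
    by under eq_bigr do rewrite col_mxEu.
  by rewrite col_mxEd mxE scale0r.
have card_s a b : ((p ^ s) ^ (a * b) = p ^ ((s - 1) * a * b) * p ^ (a * b))%N.
  by rewrite -expnM -expnD -mulnA -mulSnr subn1 prednK.
have pos a : (0 < p ^ a)%N by rewrite expn_gt0 p0.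
split.
  rewrite ler_nat mulnC.
  have -> : (p ^ ((s - 1) * m * l))%N
      = #|[pred E : 'M['Z_(p ^ s)]_(m, l) | map_mx pi E == 0%R]|.
    apply/eqP; rewrite -(eqn_pmul2r (pos (m * l)%N)) -card_s.
    by have := card_red0 pi_surj m l; rewrite cardZ // card_Fp // => ->.
  exact: independence_number_lift_le pi1_unit pi1_bij pi_unit pi_surj C_unit.
have card_u b : #|[pred M : 'M['Z_(p ^ s)]_(m, b) | unimod pi M]|
    = (\prod_(i < m) (p ^ b - p ^ i) * p ^ ((s - 1) * m * b))%N.
  apply/eqP; rewrite -(eqn_pmul2r (pos (m * b)%N)) -mulnA -card_s.
  by have := card_unimod pi_surj m b; rewrite cardZ // card_Fp // => ->.
have := independence_number_le pi_unit pi_surj (m.+1 + l) m.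
rewrite !card_u mulnDr (expnD p ((s - 1) * m * m.+1)).
(* Cancelling [p ^ ((s - 1) * m * m.+1)] leaves [p ^ ((s - 1) * m * l)], the power in the claim. *)
rewrite mulnA [X in (_ <= _ * X)%N]mulnC mulnA leq_pmul2r // => le_a.
have lt_mn : (m < m.+1 + l)%N by rewrite leq_addr.
have := gauss_binom_quot p1 lt_mn; rewrite addKn => ->.
rewrite mulrA ler_pdivlMr -?natrM ?ler_nat.
  by rewrite [X in (_ <= X)%N]mulnC.
rewrite ltr0n; apply: prodn_gt0 => i; rewrite subn_gt0 ltn_exp2l //.
exact: leq_trans (ltn_ord i) (leqnSn m).
Qed.
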